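(* Let $k\geq 2$ and $n\geq 1$ be integers. Define \[ D_{0}:=\{(x_1,\dots,x_k)\in(\{0,1\}^{n})^{k}: \forall i\in[n],\ x_{1}(i) + \dots + x_{k}(i)\leq 1 \}, \] \[ D_{*}:=\{(x_1,\dots,x_k)\in(\{0,1\}^{n})^{k}: \exists \ell\in[n],\ x_{1}(\ell) = \cdots =x_{k}(\ell)=1\text{ and } \forall i\neq \ell,\ x_{1}(i) + \dots + x_{k}(i)\leq 1 \}. \] Let $R=X_1\times\cdots\times X_k\subseteq(\{0,1\}^{n})^{k}$ (with $X_j\subseteq\{0,1\}^n$) be a rectangle such that $|R\cap D_{0}|\geq 2^{-n/k}\cdot |D_{0}|$. Then $R\cap D_{*}\neq\emptyset$.
   Context: A string $x\in\{0,1\}^n$ represents the subset $\{i: x(i)=1\}$ of $[n]$; $D_0$ is the set of \textsf{no} instances (pairwise disjoint sets) and $D_*$ the set of \textsf{yes} instances (sets sharing exactly one common element, otherwise pairwise disjoint) of $k$-party unique-disjointness. *)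

(* Defs.v *)
From HB Require Import structures.
From mathcomp Require Export all_boot all_order all_algebra.
From mathcomp Require Export reals exp.

Set Implicit Arguments.
Unset Strict Implicit.
Unset Printing Implicit Defensive.

Definition bitstring (n : nat) := {ffun 'I_n -> bool}.

Definition input (k n : nat) := {ffun 'I_k -> bitstring n}.

Definition D0 (k n : nat) : {set input k n} :=
  [set x : input k n | [forall i : 'I_n, \sum_(j < k) x j i <= 1]].

Definition Dstar (k n : nat) : {set input k n} :=
  [set x : input k n |
    [exists l : 'I_n,
      [forall j : 'I_k, x j l] &&
      [forall i : 'I_n, (i != l) ==> (\sum_(j < k) x j i <= 1)]]].

Definition rectangle (k n : nat) (X : 'I_k -> {set bitstring n}) :
    {set input k n} :=
  [set x : input k n | [forall j : 'I_k, x j \in X j]].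

(* Main.v *)
Require Import Defs.
From mathcomp Require Import all_boot all_order all_algebra.
From mathcomp Require Import reals exp.
From mathcomp Require Import zify.
Import Order.TTheory GRing.Theory Num.Theory.

Set Implicit Arguments.
Unset Strict Implicit.
Unset Printing Implicit Defensive.

(** A rectangle [X_1 x ... x X_k] avoiding [Dstar] meets [D0] in at most [k ^ n]
    points, by induction on [n]. Let [X_j^b] be the set of [y] with [b y] in
    [X_j]. For each [j], the rectangle with sides [X_j^0 u X_j^1] and [X_i^0]
    ([i != j]) still avoids [Dstar], and a disjoint tuple [y] has at most as many
    disjoint extensions in the rectangle as there are [j] such that [y] is in the
    [j]-th of these [k] rectangles: if all [y_j] are in [X_j^0] this says that
    [1 + #{j : y_j in X_j^1} <= k], which holds as otherwise [(1 y_1, ..., 1 y_k)]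
    would be in [Dstar]. Since [#|D0| = (k + 1) ^ n] and [2 k^k < (k + 1)^k] for
    [k >= 2], the theorem follows. *)

Definition bcons n (b : bool) (y : bitstring n) : bitstring n.+1 :=
  [ffun i => if unlift ord0 i is Some i' then y i' else b].

Definition icons k n (b : 'I_k -> bool) (y : input k n) : input k n.+1 :=
  [ffun j => bcons (b j) (y j)].

Definition itail k n (x : input k n.+1) : input k n :=
  [ffun j => [ffun i => x j (lift ord0 i)]].

(** The [k + 1] columns possible in a disjoint tuple: [None] is the zero column, [Some j] the [j]-th
    unit vector. *)
Definition ocol k (o : option 'I_k) : 'I_k -> bool :=
  fun i => if o is Some j then i == j else false.

Lemma bcons0 n b (y : bitstring n) : bcons b y ord0 = b.
Proof. by rewrite ffunE unlift_none. Qed.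

Lemma bcons_lift n b (y : bitstring n) i : bcons b y (lift ord0 i) = y i.
Proof. by rewrite ffunE liftK. Qed.

Lemma icons0 k n b (y : input k n) j : icons b y j ord0 = b j.
Proof. by rewrite ffunE bcons0. Qed.

Lemma icons_lift k n b (y : input k n) j i : icons b y j (lift ord0 i) = y j i.
Proof. by rewrite ffunE bcons_lift. Qed.

Lemma iconsK k n (b : 'I_k -> bool) : cancel (icons b) (@itail k n).
Proof. by move=> y; apply/ffunP=> j; apply/ffunP=> i; rewrite !ffunE liftK. Qed.

Lemma sum_bool_le1P k (b : 'I_k -> bool) :
  reflect (exists o, b =1 ocol o) (\sum_(j < k) b j <= 1).
Proof.
apply: (iffP idP) => [le1|[[j|] eb]].
- case: (pickP b) => [j bj|b0]; last by exists None => j; rewrite b0.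
  exists (Some j) => i /=; apply/idP/eqP => [bi|->//]; apply/eqP.
  case: (eqVneq i j) => // neq.
  by move: le1; rewrite (bigD1 j) //= (bigD1 i) //= bj bi.
- by rewrite (bigD1 j) //= eb big1 ?addn0 ?leq_b1 // => i /negPf; rewrite eb /= => ->.
- by rewrite big1 // => j _; rewrite eb.
Qed.

Lemma icons_D0 k n (b : 'I_k -> bool) (y : input k n) :
  (icons b y \in D0 k n.+1) = (\sum_(j < k) b j <= 1) && (y \in D0 k n).
Proof.
rewrite !inE; apply/forallP/andP => [h|[hb /forallP hy] i].
  split; first by have := h ord0; under eq_bigr do rewrite icons0.
  by apply/forallP=> i; have := h (lift ord0 i); under eq_bigr do rewrite icons_lift.
case: (unliftP ord0 i) => [i'|] ->; last by under eq_bigr do rewrite icons0.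
by under eq_bigr do rewrite icons_lift.
Qed.

Lemma icons_Dstar k n (b : 'I_k -> bool) (y : input k n) :
  \sum_(j < k) b j <= 1 -> y \in Dstar k n -> icons b y \in Dstar k n.+1.
Proof.
move=> hb; rewrite !inE => /existsP[l /andP[/forallP h1 /forallP h2]].
apply/existsP; exists (lift ord0 l); apply/andP; split.
  by apply/forallP=> j; rewrite icons_lift.
apply/forallP=> i; apply/implyP.
case: (unliftP ord0 i) => [i'|] -> neq; last by under eq_bigr do rewrite icons0.
under eq_bigr do rewrite icons_lift.
by apply: (implyP (h2 i')); apply: contra neq => /eqP->.
Qed.

Lemma icons1_Dstar k n (y : input k n) :
  y \in D0 k n -> icons xpredT y \in Dstar k n.+1.
Proof.
rewrite !inE => /forallP hy; apply/existsP; exists ord0; apply/andP; split.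
  by apply/forallP=> j; rewrite icons0.
apply/forallP=> i; apply/implyP.
case: (unliftP ord0 i) => [i'|] -> neq; last by rewrite eqxx in neq.
by under eq_bigr do rewrite icons_lift.
Qed.

Lemma icons_itail k n (x : input k n.+1) b :
  (fun j => x j ord0) =1 b -> icons b (itail x) = x.
Proof.
move=> eb; apply/ffunP=> j; apply/ffunP=> i.
case: (unliftP ord0 i) => [i'|] ->; last by rewrite icons0 eb.
by rewrite icons_lift !ffunE.
Qed.

(** Splitting off the first column is a bijection. Constant [F] counts [D0]; the indicator of a
    rectangle drives the induction. *)
Lemma sum_D0_recl k n (F : input k n.+1 -> nat) :
  \sum_(x in D0 k n.+1) F x =
  \sum_(y in D0 k n) \sum_(o : option 'I_k) F (icons (ocol o) y).
Proof.
rewrite pair_big_dep /=.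
(* On [D0] the first column has at most one 1, so [pick] inverts [ocol], with [None] for the zero
   column. *)
pose col0 (x : input k n.+1) := [pick j | x j ord0].
rewrite (reindex (fun p => icons (ocol p.2) p.1)) /=.
  apply: eq_bigl => -[y o] /=; rewrite icons_D0 andbT.
  by have /sum_bool_le1P -> : exists o', ocol o =1 ocol o' by exists o.
exists (fun x => (itail x, col0 x)) => [[y o] _|x /=].
  rewrite /= iconsK; congr pair; rewrite /col0.
  case: pickP => [j|]; first by rewrite icons0; case: o => // j' /eqP->.
  by case: o => // j /(_ j); rewrite icons0 /= eqxx.
rewrite inE => /forallP/(_ ord0)/sum_bool_le1P[o eo].
apply: icons_itail => j; rewrite eo /col0.
case: pickP => [i|h]; last by rewrite -eo h.
by rewrite eo; case: o {eo} => // j' /eqP->.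
Qed.

Lemma card_D0 k n : #|D0 k n| = k.+1 ^ n.
Proof.
elim: n => [|n IHn].
  have -> : D0 k 0 = setT by apply/setP=> x; rewrite !inE; apply/forallP=> -[].
  by rewrite cardsT !card_ffun !card_ord exp1n.
rewrite -sum1_card sum_D0_recl.
under eq_bigr do rewrite sum1_card card_option card_ord.
by rewrite sum_nat_const IHn expnSr.
Qed.

Lemma sum_option (T : finType) (F : option T -> nat) :
  \sum_o F o = F None + \sum_x F (Some x).
Proof.
rewrite (bigD1 None) //= (reindex_omap Some id) => [|[]//].
by congr addn; apply: eq_bigl => x; rewrite eqxx.
Qed.

Definition slice n (b : bool) (A : {set bitstring n.+1}) : {set bitstring n} :=
  [set y | bcons b y \in A].

(** Only party [j] has a choice about the new element, so projecting the tuples whose first column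
    is zero or the [j]-th unit vector still gives a rectangle. *)
Definition proj_rect k n (X : 'I_k -> {set bitstring n.+1}) (j i : 'I_k) :
    {set bitstring n} :=
  if i == j then slice false (X i) :|: slice true (X i) else slice false (X i).

Lemma icons_rectangle k n (X : 'I_k -> {set bitstring n.+1}) b (y : input k n) :
  (icons b y \in rectangle X) = [forall j, y j \in slice (b j) (X j)].
Proof. by rewrite inE; apply: eq_forallb => j; rewrite ffunE inE. Qed.

Lemma proj_rectP k n (X : 'I_k -> {set bitstring n.+1}) j (y : input k n) :
  reflect (icons (ocol None) y \in rectangle X \/
           icons (ocol (Some j)) y \in rectangle X)
          (y \in rectangle (proj_rect X j)).
Proof.
rewrite !icons_rectangle [y \in _]inE; apply: (iffP forallP) => [h|].
  have := h j; rewrite /proj_rect eqxx => /setUP[] yj; [left|right];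
    apply/forallP=> i; have := h i; rewrite /proj_rect /=;
    by have [->|] := eqVneq i j.
by case=> /forallP h i; have := h i; rewrite /proj_rect /=;
  have [->|] := eqVneq i j; rewrite ?inE // => ->; rewrite ?orbT.
Qed.

Lemma card_rectangle_D0_le k n (X : 'I_k -> {set bitstring n}) :
  [disjoint rectangle X & Dstar k n] -> #|rectangle X :&: D0 k n| <= k ^ n.
Proof.
have cardE m (Y : 'I_k -> {set bitstring m}) :
    #|rectangle Y :&: D0 k m| = \sum_(y in D0 k m) (y \in rectangle Y : nat).
  rewrite -sum1_card big_mkcond [RHS]big_mkcond; apply: eq_bigr => y _.
  by rewrite in_setI; do 2 case: (y \in _).
elim: n X => [|n IHn] X dis.
  apply: leq_trans (max_card _) _.
  by rewrite !card_ffun !card_ord exp1n.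
have free b y : icons b y \in rectangle X -> icons b y \notin Dstar k n.+1.
  by move/(disjointFr dis)->.
rewrite cardE sum_D0_recl.
apply: (@leq_trans (\sum_(j < k) #|rectangle (proj_rect X j) :&: D0 k n|)).
  under [leqRHS]eq_bigr do rewrite cardE.
  rewrite [leqRHS]exchange_big /=; apply: leq_sum => y yD0.
  rewrite sum_option.
  (* If the zero extension is present, [y] lies in all [k] projections and the right side is [k]. *)
  have [y0|/negPf y0] := boolP (icons (ocol None) y \in rectangle X).
    under [leqRHS]eq_bigr => j _.
      have -> : y \in rectangle (proj_rect X j) by apply/proj_rectP; left.
      over.
    have /forallPn [j yj] : ~~ [forall j, y j \in slice true (X j)].
      apply/negP=> h; suff /free : icons xpredT y \in rectangle X.
        by rewrite icons1_Dstar.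
      by rewrite icons_rectangle.
    (* The extension by [Some j] is missing, so the [j]-th unit on the right pays for the zero
       extension. *)
    rewrite (bigD1 j) //= [leqRHS](bigD1 j) //= leq_add2l.
    have /negPf -> : icons (ocol (Some j)) y \notin rectangle X.
      rewrite icons_rectangle; apply: contra yj => /forallP/(_ j).
      by rewrite /= eqxx.
    by rewrite add0n; apply: leq_sum => i _; apply: leq_b1.
  rewrite add0n; apply: leq_sum => j _.
  case: (boolP (icons _ y \in _)) => // yj.
  by have -> : y \in rectangle (proj_rect X j) by apply/proj_rectP; right.
rewrite expnS -[X in X * _]card_ord -sum_nat_const; apply: leq_sum => j _.
(* A yes instance in the projection would extend, by a column with at most one 1, to a yes instance
   in [rectangle X]. *)
apply: IHn; apply/pred0P => y /=; apply/negbTE/andP => -[/proj_rectP yP yD].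
by case: yP => /free /negP[]; apply: icons_Dstar yD; apply/sum_bool_le1P;
  [exists None | exists (Some j)].
Qed.

(** The left side is the top two binomial terms; an exponent of at least 2 leaves a positive
    remainder. *)
Lemma bernoulli_lt x m : 0 < x -> x ^ m.+2 + m.+2 * x ^ m.+1 < x.+1 ^ m.+2.
Proof.
move=> x0; elim: m => [|m IHm]; first by rewrite !expnS expn0; nia.
have : 0 < x ^ m.+1 by rewrite expn_gt0 x0.
by move: IHm; rewrite (expnS x.+1 m.+2) (expnS x m.+2) (expnS x m.+1); nia.
Qed.

Lemma expn_self_lt k : 1 < k -> 2 * k ^ k < k.+1 ^ k.
Proof.
(* With base equal to exponent, the second term is another copy of the first. *)
case: k => [|[|k]] // _; have := @bernoulli_lt k.+2 k isT.
by rewrite -expnS addnn mul2n.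
Qed.

Theorem theorem1p1 (R : realType) (k n : nat) (hk : (2 <= k)%N) (hn : (1 <= n)%N)
    (X : 'I_k -> {set bitstring n})
    (hX : ((2 : R) `^ (- (n%:R / k%:R)) * #|D0 k n|%:R
             <= #|rectangle X :&: D0 k n|%:R)%R) :
  rectangle X :&: Dstar k n != set0.
Proof.
rewrite setI_eq0; apply/negP => /card_rectangle_D0_le le.
have k0 : (k%:R != 0 :> R)%R by rewrite pnatr_eq0; case: k hk {X hX le}.
have {hX le} : ((2 : R) `^ (- (n%:R / k%:R)) * (k.+1 ^ n)%:R <= (k ^ n)%:R)%R.
  by rewrite -card_D0; apply: le_trans hX _; rewrite ler_nat.
(* The [k]-th power turns the real factor into [2 ^ -n], leaving an inequality in [nat] between
   [n]-th powers; [0 < n] allows taking roots. *)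
move=> /(lerXn2r k); rewrite !nnegrE mulr_ge0 ?powR_ge0 ?ler0n //.
move=> /(_ isT isT); rewrite exprMn -powR_mulrn ?powR_ge0 // -powRrM.
rewrite mulNr divfK // powRN powR_mulrn ?ler0n //.
rewrite mulrC ler_pdivrMr ?exprn_gt0 ?ltr0n //.
rewrite -!natrX -natrM ler_nat -!expnM ![n * k]mulnC !expnM -expnMn mulnC.
by rewrite leq_exp2r // leqNgt expn_self_lt.
Qed.
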